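(* Let $X$ be a proper $\mathrm{CAT}(0)$ space. Suppose a free abelian group of rank $n$, $\mathbb{Z}^n$, is acting properly on $X$ by isometries. Then $\dim X\ge n$. If $\dim X=n$ then the action is by semi-simple isometries.
   Context: A metric space is proper if all its closed balls are compact. $\dim$ is the covering dimension. An isometric action of a discrete group $G$ on a metric space $X$ is proper if for every $x\in X$ there is $r>0$ such that $\{g\in G : gB(x,r)\cap B(x,r)\neq\emptyset\}$ is finite, $B(x,r)$ being the closed ball. An isometry $f$ of $X$ is elliptic if it fixes a point, hyperbolic if there is an $f$-invariant bi-infinite geodesic on which $f$ acts as a non-trivial translation, and parabolic otherwise; it is semi-simple if it is elliptic or hyperbolic. An action is by semi-simple isometries if every group element acts as a semi-simple isometry. *)

(* Defs.v *)
From HB Require Import structures.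
From mathcomp Require Import all_boot all_order all_algebra.
From mathcomp Require Import all_classical all_reals all_analysis.

Set Implicit Arguments.
Unset Strict Implicit.
Unset Printing Implicit Defensive.

Import Order.TTheory GRing.Theory Num.Theory.

Local Open Scope classical_set_scope.
Local Open Scope ring_scope.

Section MetricSpaces.
Context {R : realType} {X : metricType R}.

(* The library's [closed_ball] is the closure of the open ball, which in a
   general metric space can be smaller than this set. *)
Definition metric_closed_ball (x : X) (r : R) : set X :=
  [set y | mdist x y <= r].

Definition is_geodesic (c : R -> X) (x y : X) : Prop :=
  [/\ c 0 = x, c (mdist x y) = y &
      {in `[0, mdist x y] &, forall s t, mdist (c s) (c t) = `|s - t|}].

Definition geodesic_segment (x y : X) (S : set X) : Prop :=
  exists c, is_geodesic c x y /\ S = c @` `[0, mdist x y].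

Definition geodesic_line (c : R -> X) : Prop :=
  forall s t, mdist (c s) (c t) = `|s - t|.

Definition isometry (f : X -> X) : Prop :=
  bijective f /\ forall x y, mdist (f x) (f y) = mdist x y.

Definition elliptic (f : X -> X) : Prop := exists x, f x = x.

Definition hyperbolic (f : X -> X) : Prop :=
  exists c : R -> X, geodesic_line c /\
    exists2 a : R, a != 0 & forall t, f (c t) = c (t + a).

Definition semi_simple (f : X -> X) : Prop := elliptic f \/ hyperbolic f.

End MetricSpaces.

Section CAT0.
Context {R : realType}.

(* The norm that the library puts on ['rV[R]_2] is the sup norm. *)
Definition euclidean_dist (u v : 'rV[R]_2) : R :=
  Num.sqrt (\sum_i (u 0 i - v 0 i) ^+ 2).

Definition euclidean_segment (u v : 'rV[R]_2) : set 'rV[R]_2 :=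
  [set (1 - t) *: u + t *: v | t in `[0, 1]].

Variable X : metricType R.

Definition proper_space : Prop :=
  forall (x : X) (r : R), compact (metric_closed_ball x r).

Definition geodesic_space : Prop :=
  forall x y : X, exists S, geodesic_segment x y S.

(* [side i j] is the chosen segment from [v i] to [v j]; the diagonal sides
   are forced to be the singletons [[set v i]]. *)
Definition geodesic_triangle (v : 'I_3 -> X) (side : 'I_3 -> 'I_3 -> set X)
    : Prop :=
  (forall i j, geodesic_segment (v i) (v j) (side i j)) /\
  (forall i j, side i j = side j i).

Definition comparison_triangle (v : 'I_3 -> X) (w : 'I_3 -> 'rV[R]_2) : Prop :=
  forall i j, euclidean_dist (w i) (w j) = mdist (v i) (v j).

Definition comparison_point (v : 'I_3 -> X) (w : 'I_3 -> 'rV[R]_2)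
    (i j : 'I_3) (p : X) (p' : 'rV[R]_2) : Prop :=
  euclidean_segment (w i) (w j) p' /\
  euclidean_dist (w i) p' = mdist (v i) p.

Definition CAT0 : Prop :=
  geodesic_space /\
  forall v side w, geodesic_triangle v side -> comparison_triangle v w ->
  forall i j k l p q p' q',
    side i j p -> comparison_point v w i j p p' ->
    side k l q -> comparison_point v w k l q q' ->
    mdist p q <= euclidean_dist p' q'.

End CAT0.

Section CoveringDimension.
Context {R : realType} (X : metricType R).

Definition open_cover (U : set (set X)) : Prop :=
  (forall A, U A -> open A) /\ \bigcup_(A in U) A = [set: X].

Definition refines (V U : set (set X)) : Prop :=
  forall B, V B -> exists2 A, U A & B `<=` A.

Definition order_at_most (V : set (set X)) (k : nat) : Prop :=
  forall x, ([set B | V B /\ B x] #<= `I_k)%card.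

Definition has_refinements_of_order (k : nat) : Prop :=
  forall U, open_cover U ->
    exists V, [/\ open_cover V, refines V U & order_at_most V k].

(* [dim X <= m] iff every open cover has an open refinement with at most
   [m + 1] members through each point; the value is [+oo] if there is no such
   [m], and [-1] for the empty space. *)
Definition covering_dim : \bar R :=
  ereal_inf [set (k%:R - 1)%:E | k in has_refinements_of_order].

End CoveringDimension.

Section Actions.
Context {R : realType} {X : metricType R} {G : zmodType}.

Definition isometric_action (act : G -> X -> X) : Prop :=
  [/\ forall x, act 0 x = x,
      forall g h x, act (g + h) x = act g (act h x) &
      forall g, isometry (act g)].

Definition proper_action (act : G -> X -> X) : Prop :=
  forall x, exists2 r : R, 0 < r &
    finite_set [set g | (act g @` metric_closed_ball x r)
                          `&` metric_closed_ball x r !=set0].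

Definition semi_simple_action (act : G -> X -> X) : Prop :=
  forall g, semi_simple (act g).

End Actions.

(* Main.v *)
Require Import Defs.
From mathcomp Require Import all_boot all_order all_algebra.
From mathcomp Require Import all_classical all_reals all_analysis.
From mathcomp Require Import zify ring lra.

Set Implicit Arguments.
Unset Strict Implicit.
Unset Printing Implicit Defensive.

Import Order.TTheory GRing.Theory Num.Theory.
Import numFieldNormedType.Exports.

Local Open Scope classical_set_scope.
Local Open Scope ring_scope.

(** The topological input is that an [n]-dimensional grid cannot be mapped to a
    space of small covering dimension with small steps unless opposite faces
    come close: [grid_coloring], a form of Lebesgue's covering theorem, finds in
    any colouring of the grid in which no colour meets two opposite faces a unit
    cube carrying [n + 1] colours.  Colouring the vertices by members of a fine
    open cover gives [refinement_order_gt]: if for all [lam > 0] a fixed ball of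
    [X] receives an [n]-grid with steps below [lam] and with opposite faces a
    fixed distance apart, then some open cover has no open refinement with at
    most [n] members through each point.

    For the inequality [dim X >= n], the orbit of a point under [Z^n] is extended
    to a grid by interpolating along geodesics, one coordinate after the other
    ([flat]).  Convexity of the metric makes the steps small, and properness of
    the action keeps opposite faces of a large box apart, because the map stays
    within a bounded distance of the orbit ([refinement_order_flat]).

    For semi-simplicity, let [disp y = d(y, g y)].  It is convex, and it is
    invariant under [Z^n] because the group is commutative.  If it attains its
    minimum, the midpoint inequality shows that [g ^ (2 ^ k)] translates a
    minimal point by [2 ^ k] times the minimum, so the translates of the segment
    from [x] to [g x] form an axis, unless [g x = x]
    ([min_displacement_semi_simple]).  If it does not attain its minimum, an
    extra dimension appears ([refinement_order_no_min]).  The interpolated orbit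
    of [x0] lies within a bounded distance of the orbit, so by invariance and
    compactness [disp] has there a lower bound [disp y0]; as [disp y0] is not
    minimal, there is [x1] with [disp x1 < disp y0], and by convexity [disp] is
    at most [disp x1] on the interpolated orbit of [x1].  Joining the two maps by
    geodesics gives an [(n + 1)]-dimensional grid whose two new faces are
    separated by the values of [disp]; hence [dim X >= n + 1]. *)

(** * Parity of the number of fully labelled rooms *)

Lemma F2_addxx (x : 'F_2) : x + x = 0.
Proof.
by rewrite -mulr2n -mulr_natl (_ : 2%:R = 0) ?mul0r //; apply/val_inj.
Qed.

Lemma F2_sign (x : 'F_2) m : (-1) ^+ m * x = x.
Proof.
have -> : (-1 : 'F_2) = 1 by apply/val_inj.
by rewrite expr1n mul1r.
Qed.

(** Terms exchanged by the involution are equal, so they cancel in pairs. *)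
Lemma F2_sum_involution (I : finType) (P : pred I) (f : I -> 'F_2) (s : I -> I) :
  (forall u, P u -> P (s u)) -> (forall u, P u -> s (s u) = u) ->
  (forall u, P u -> f (s u) = f u) -> (forall u, P u -> s u = u -> f u = 0) ->
  \sum_(u | P u) f u = 0.
Proof.
move=> sP sK sf fix0; pose r (u : I) : nat := enum_rank u.
rewrite (bigID (fun u => r u < r (s u))%N) /=.
rewrite [X in _ + X](bigID (fun u => r (s u) < r u)%N) /=.
rewrite [X in _ + (_ + X)]big1 ?addr0; last first.
  move=> u /andP[/andP[Pu]]; rewrite -!leqNgt => h1 h2; apply: fix0 => //.
  by apply: enum_rank_inj; apply: val_inj; apply/eqP; rewrite eqn_leq; apply/andP.
rewrite [X in _ + X](_ : _ = \sum_(u | P u && (r u < r (s u))%N) f u).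
  exact: F2_addxx.
rewrite (reindex_onto s s) /=; last by move=> u /andP[/andP[Pu _] _]; exact: sK.
apply: eq_big => u.
  apply/idP/idP.
    case/andP=> /andP[/andP[Psu _] h] /eqP ssu.
    have Pu : P u by rewrite -ssu; exact: sP.
    by rewrite Pu /=; move: h; rewrite ssu.
  case/andP=> Pu h; rewrite sP ?sK // h eqxx andbT /=.
  by rewrite -leqNgt ltnW.
by case/andP=> /andP[/andP[Psu _] h] /eqP ssu; apply: sf; rewrite -ssu; exact: sP.
Qed.

Lemma dvdn_addn_inj p x s t :
  (s < p)%N -> (t < p)%N -> (p %| x + s)%N -> (p %| x + t)%N -> s = t.
Proof.
move=> sp tp; wlog st : s t sp tp / (s <= t)%N => [H|] ps pt.
  by case/orP: (leq_total s t) => ?; [exact: H | symmetry; exact: H].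
have := dvdn_sub pt ps; rewrite subnDl.
have [ts0 _|ts_gt0] := posnP (t - s).
  by apply/eqP; rewrite eqn_leq st /= -subn_eq0 ts0.
by move/(dvdn_leq ts_gt0); lia.
Qed.

(** The rooms are the top-dimensional simplices of Kuhn's triangulation of the
    cube [[0, M]^k], seen as the face of [[0, M]^d] on which the last [d - k]
    coordinates are [M].  A room is encoded by a vector [u]: its vertex number
    [t] has coordinates [(u j + t) %/ p], so that moving on by one step
    increments the coordinates with [u j + t + 1] divisible by [p].  This
    encoding, which also contains degenerate rooms, makes both adjacencies
    simple: dropping the first vertex of [u] leaves the same wall as dropping the
    last vertex of [u + 1], and dropping an inner vertex is undone by a swap of
    residues.  A single modulus [p = d + 1] serves all dimensions [k <= d]. *)
Section Kuhn.
Variables (d M : nat) (lab : ('I_d -> nat) -> nat).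
Hypothesis lab_lo : forall v (i : 'I_d),
  (forall j, v j <= M)%N -> v i = 0%N -> lab v != i.
Hypothesis lab_hi : forall v (i : 'I_d),
  (forall j, v j <= M)%N -> v i = M -> (lab v <= i)%N.

Let p := d.+1.
Let L := (p * M)%N.
Let room := {ffun 'I_d -> 'I_L.+1}.

Definition room_vertex (u : room) (t : nat) : 'I_d -> nat :=
  fun j => ((u j + t) %/ p)%N.

(** Modulo 2, the determinant of this matrix is 1 exactly when the labels of the
    vertices, truncated at [k], are [0, ..., k] in some order; degenerate rooms
    have two equal rows and count for 0.  The column of ones is the sum of the
    indicator columns of all labels [<= k] when no label exceeds [k]. *)
Definition room_mx k (u : room) : 'M['F_2]_k.+1 :=
  \matrix_(t, i) if i == ord_max then 1 else (lab (room_vertex u t) == i)%:R.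

Definition door_mx k (t : 'I_k.+2) (u : room) : 'M['F_2]_k.+1 :=
  \matrix_(s, i) (lab (room_vertex u (lift t s)) == i)%:R.

Definition room_dom k (u : room) : bool :=
  [forall j : 'I_d, if (j < k)%N then (u j < L)%N else u j == L :> nat].

Let room_count k := \sum_(u | room_dom k u) \det (room_mx k u).

Lemma room_vertex_le u t j : (t < p)%N -> (room_vertex u t j <= M)%N.
Proof.
move=> tp; rewrite /room_vertex -ltnS ltn_divLR // mulSn [(M * p)%N]mulnC.
by have := ltn_ord (u j); rewrite -/L; lia.
Qed.

(** Expansion along the column of ones: a room is counted by its doors. *)
Lemma det_room_mx k u :
  \det (room_mx k.+1 u) = \sum_(t < k.+2) \det (door_mx t u).
Proof.
rewrite (expand_det_col _ ord_max); apply: eq_bigr => t _.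
rewrite !mxE eqxx mul1r /cofactor F2_sign; congr (\det _).
apply/matrixP => s i; rewrite !mxE lift_max.
by rewrite eq_sym (negbTE (neq_lift _ _)).
Qed.

(** The room on the other side of the wall opposite to vertex [t]: the
    coordinates incremented just before and just after vertex [t] exchange their
    turns. *)
Definition swap_room (t : nat) (u : room) : room :=
  [ffun j => inord (if (p %| u j + t)%N then (u j).-1
                    else if (p %| u j + t.+1)%N then (u j).+1 else u j)].

Lemma swap_roomE t u j : (t.+1 < p)%N ->
  swap_room t u j = (if (p %| u j + t)%N then (u j).-1
                    else if (p %| u j + t.+1)%N then (u j).+1 else u j) :> nat.
Proof.
move=> tp; rewrite ffunE inordK //.
case: ifP => _; first by rewrite ltnS (leq_trans (leq_pred _)) // -ltnS.
case: ifP => // h2; rewrite ltnS ltn_neqAle -ltnS ltn_ord andbT.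
apply/negP => /eqP uL; move: h2; rewrite uL dvdn_addr ?dvdn_mulr //.
by move/dvdn_leq => /(_ isT); rewrite leqNgt tp.
Qed.

Lemma swap_room_vertex t u s : (t.+1 < p)%N -> (0 < t)%N -> (s < p)%N ->
  s != t -> room_vertex (swap_room t u) s = room_vertex u s.
Proof.
move=> tp t0 sp st; apply/funext => j; rewrite /room_vertex swap_roomE //.
case: ifP => [h1|h1].
  have /prednK uj0 : (0 < u j)%N.
    rewrite lt0n; apply/eqP => u0; move: h1; rewrite u0 add0n.
    by move/(dvdn_leq t0); lia.
  rewrite -[in RHS]uj0 addSn divnS // [X in nat_of_bool X](_ : _ = false) //.
  apply/negP; rewrite -addSn uj0 => h; move/eqP: st; apply.
  by apply: (dvdn_addn_inj sp _ h h1); lia.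
case: ifP => // h2; rewrite addSn divnS // [X in nat_of_bool X](_ : _ = false) //.
apply/negP; rewrite -addnS => h; move: st; rewrite -eqSS => /eqP; apply.
have [sp'|] := ltnP s.+1 p; first exact: (dvdn_addn_inj sp' _ h h2).
move=> ps; have sE : s.+1 = p by lia.
move: h; rewrite sE dvdn_addl // => pu; move: h2; rewrite dvdn_addr //.
by move/dvdn_leq => /(_ isT); rewrite leqNgt tp.
Qed.

Lemma swap_roomK t u : (t.+1 < p)%N -> (0 < t)%N -> swap_room t (swap_room t u) = u.
Proof.
move=> tp t0; apply/ffunP => j; apply: val_inj => /=.
rewrite !swap_roomE //; case: (boolP (p %| u j + t)%N) => h1.
  have /prednK uj0 : (0 < u j)%N.
    rewrite lt0n; apply/eqP => u0; move: h1; rewrite u0 add0n.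
    by move/(dvdn_leq t0); lia.
  rewrite ifF; last first.
    apply/negP => h; have : (p %| (u j + t) - ((u j).-1 + t))%N by exact: dvdn_sub.
    by move/dvdn_leq; lia.
  by rewrite addnS -addSn uj0 h1.
case: (boolP (p %| u j + t.+1)%N) => h2; first by rewrite addSn -addnS h2.
by rewrite (negbTE h1) (negbTE h2).
Qed.

Lemma swap_room_dom t k u : (t <= k)%N -> (0 < t)%N -> (k < d)%N ->
  room_dom k.+1 u -> room_dom k.+1 (swap_room t u).
Proof.
move=> tk t0 kd /forallP du; have tp : (t.+1 < p)%N by rewrite /p; lia.
apply/forallP => j; have := du j; rewrite swap_roomE //; case: ifP => _ uj.
  case: ifP => [_|h1]; first exact: leq_ltn_trans (leq_pred _) uj.
  case: ifP => // h2; rewrite ltn_neqAle uj andbT; apply/negP => /eqP uL.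
  move: h2; rewrite addnS -addSn uL dvdn_addr ?dvdn_mulr //.
  by move/(dvdn_leq t0); lia.
move: (eqP uj) => ->.
rewrite [(p %| L + t)%N]dvdn_addr ?dvdn_mulr //.
rewrite [(p %| L + t.+1)%N]dvdn_addr ?dvdn_mulr //.
by rewrite !gtnNdvd //; lia.
Qed.

Lemma room_vertexS (u : room) t : (forall j, ~~ (p %| u j + t.+1)%N) ->
  room_vertex u t.+1 = room_vertex u t.
Proof.
move=> h; apply/funext => j.
by rewrite /room_vertex addnS divnS // -addnS (negbTE (h j)).
Qed.

(** Doors opposite to an inner vertex occur in pairs; a door fixed by the swap
    comes from a room whose vertices [t - 1], [t] and [t + 1] coincide. *)
Lemma sum_inner_door k (t : 'I_k.+2) : (k < d)%N -> t != ord0 -> t != ord_max ->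
  \sum_(u | room_dom k.+1 u) \det (door_mx t u) = 0.
Proof.
move=> kd tn0 tmax.
have t0 : (0 < t)%N by rewrite lt0n.
have tk : (t <= k)%N.
  by have := ltn_ord t; move: tmax; rewrite -(inj_eq val_inj) /=; lia.
have tp : (t.+1 < p)%N by rewrite /p; lia.
apply: (@F2_sum_involution _ _ _ (swap_room t)).
- by move=> u; apply: swap_room_dom.
- by move=> u _; apply: swap_roomK.
- move=> u _; congr (\det _); apply/matrixP => s i; rewrite !mxE.
  rewrite swap_room_vertex //; last by rewrite eq_sym; exact: neq_lift.
  by have := ltn_ord (lift t s); rewrite /p; lia.
- move=> u _ fixu.
  have fixj j : ~~ (p %| u j + t)%N /\ ~~ (p %| u j + t.+1)%N.
    have := swap_roomE u j tp; rewrite fixu.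
    case: ifP => h1.
      move=> uj; have : (0 < u j)%N; last first.
        by move: uj; case: (nat_of_ord _) => // m /=; lia.
      rewrite lt0n; apply/eqP => u0; move: h1; rewrite u0 add0n.
      by move/(dvdn_leq t0); lia.
    by case: ifP => // _; case: (nat_of_ord _) => // m /=; lia.
  have s1P : (t.-1 < k.+1)%N by lia.
  have s2P : (t < k.+1)%N by lia.
  apply: (@determinant_alternate _ _ _ (Ordinal s1P) (Ordinal s2P)).
    by rewrite -(inj_eq val_inj) /=; lia.
  move=> i; rewrite !mxE /= /bump leqnn [(t <= t.-1)%N](_ : _ = false); last by lia.
  have E : room_vertex u t = room_vertex u t.-1.
    by rewrite -[in LHS](prednK t0) room_vertexS // prednK // => j; case: (fixj j).
  by rewrite add1n add0n room_vertexS ?E // => j; case: (fixj j).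
Qed.

(** The door of [u] obtained by dropping its last vertex. *)
Definition wall_mx k (u : room) : 'M['F_2]_k.+1 :=
  \matrix_(s, i) (lab (room_vertex u s) == i)%:R.

Definition wall_dom k (u : room) : bool :=
  [forall j : 'I_d, (k < j)%N ==> (u j == L :> nat)].

Definition shift_room (f : nat -> nat) k (u : room) : room :=
  [ffun j : 'I_d => if (j <= k)%N then inord (f (u j)) else u j].

(** On the face where coordinate [j] vanishes the label [j] does not occur. *)
Lemma det_wall_lo k (u : room) (j : 'I_d) :
  (k < d)%N -> (j <= k)%N -> u j = 0%N :> nat ->
  \det (wall_mx k u) = 0.
Proof.
move=> kd jk uj; have jk' : (j < k.+1)%N by [].
rewrite (expand_det_col _ (Ordinal jk')) big1 // => s _.
have sp : (s < p)%N by rewrite /p; have := ltn_ord s; lia.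
rewrite mxE (negbTE (lab_lo _ _)) ?mul0r //.
  by move=> i; apply: room_vertex_le.
by rewrite /room_vertex uj add0n divn_small.
Qed.

Lemma lab_wall_hi k (u : room) s (j : 'I_d) :
  (k < d)%N -> (s <= k)%N -> u j = L :> nat ->
  (lab (room_vertex u s) <= j)%N.
Proof.
move=> kd sk uj; have sp : (s < p)%N by rewrite /p; lia.
apply: lab_hi; first by move=> i; apply: room_vertex_le.
by rewrite /room_vertex uj /L mulnC divnMDl // divn_small // addn0.
Qed.

(** On the face where coordinate [j < k] is [M] the label [k] does not occur. *)
Lemma det_wall_hi k (u : room) (j : 'I_d) :
  (k < d)%N -> (j < k)%N -> u j = L :> nat ->
  \det (wall_mx k u) = 0.
Proof.
move=> kd jk uj; rewrite (expand_det_col _ ord_max) big1 // => s _.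
have := lab_wall_hi kd (ltnSE (ltn_ord s)) uj => h.
by rewrite mxE ltn_eqF ?mul0r //; apply: leq_ltn_trans h jk.
Qed.

(** On the face where coordinate [k] is [M] all labels are at most [k], so the
    indicator columns add up to the column of ones: a door in that face is a
    full room of the triangulation of the face. *)
Lemma det_wall_room k u : (k < d)%N -> room_dom k u ->
  \det (wall_mx k u) = \det (room_mx k u).
Proof.
move=> kd /forallP du; have uk : u (Ordinal kd) = L :> nat.
  by have := du (Ordinal kd); rewrite /= ltnn => /eqP.
(* Multiplication by [T] adds all columns to the last one. *)
pose T : 'M['F_2]_k.+1 := \matrix_(i, j) ((i == j) || (j == ord_max))%:R.
have detT : \det T = 1.
  rewrite -det_tr det_trig; first by rewrite big1 // => i _; rewrite !mxE eqxx.
  apply/is_trig_mxP => i j ij; rewrite !mxE -[i == ord_max](inj_eq val_inj) /=.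
  by rewrite -(inj_eq val_inj) /= gtn_eqF //= ltn_eqF // (leq_trans ij) // -ltnS.
rewrite -[LHS]mulr1 -detT -det_mulmx; congr (\det _).
apply/matrixP => s i; rewrite !mxE.
have [->|iN] := eqVneq i ord_max.
  have h : (lab (room_vertex u s) < k.+1)%N.
    by rewrite ltnS (lab_wall_hi kd _ uk) // -ltnS.
  rewrite (bigD1 (Ordinal h)) //= big1 ?addr0.
    by rewrite !mxE !eqxx orbT mulr1.
  by move=> j; rewrite !mxE -(inj_eq val_inj) /= eq_sym => /negbTE ->; rewrite mul0r.
rewrite (bigD1 i) //= big1 ?addr0; first by rewrite !mxE eqxx mulr1.
by move=> j /negbTE ji; rewrite !mxE ji (negbTE iN) mulr0.
Qed.

(** Dropping the first vertex of [u] is dropping the last vertex of [u + 1].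
    The sum may be extended to the rooms with some [u j = 0], whose doors
    vanish. *)
Lemma sum_first_door k : (k < d)%N ->
  \sum_(u | room_dom k.+1 u) \det (door_mx (@ord0 k.+1) u) =
  \sum_(u | wall_dom k u) \det (wall_mx k u).
Proof.
move=> kd; rewrite [RHS](bigID
  (fun u : room => [forall j : 'I_d, (j <= k)%N ==> (0 < u j)%N])) /=.
rewrite [X in _ + X]big1 ?addr0; last first.
  move=> u /andP[_]; rewrite negb_forall => /existsP[j].
  rewrite negb_imply -leqNgt leqn0.
  by case/andP=> jk /eqP; exact: det_wall_lo.
rewrite [RHS](reindex_onto (shift_room succn k) (shift_room predn k)); last first.
  move=> u /andP[_ /forallP uj]; apply/ffunP => j; rewrite !ffunE.
  case: (boolP (j <= k)%N) => jk; rewrite ?(negbTE jk) //.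
  apply: val_inj; have := uj j; rewrite jk /=.
  move=> /prednK uj0.
  have uL : ((u j).-1 < L.+1)%N by rewrite (leq_ltn_trans (leq_pred _)).
  by rewrite (inordK uL) uj0 inordK.
have shiftE (u : room) (j : 'I_d) : (j <= k)%N -> (u j < L)%N ->
    shift_room succn k u j = (u j).+1 :> nat.
  by move=> jk uL; rewrite ffunE jk inordK.
apply: eq_big => u.
  apply/idP/idP.
    move/forallP => du; apply/andP; split; [apply/andP; split|].
    - apply/forallP => j; apply/implyP => kj; rewrite ffunE leqNgt kj /=.
      by have := du j; rewrite ltnS leqNgt kj.
    - apply/forallP => j; apply/implyP => jk; rewrite shiftE //.
      by have := du j; rewrite ltnS jk.
    - apply/eqP/ffunP => j; rewrite [LHS]ffunE.
      case: ifP => jk; last by rewrite ffunE jk.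
      have := du j; rewrite ltnS jk => uL; apply: val_inj.
      by rewrite shiftE //= inordK // -ltnS.
  case/andP=> /andP[/forallP h1 /forallP h2] /eqP h3; apply/forallP => j.
  rewrite ltnS; case: ifP => jk.
    have := congr1 (fun w : room => nat_of_ord (w j)) h3; rewrite /= ffunE jk.
    have := h2 j; rewrite jk /= => s0; rewrite inordK; last first.
      by rewrite (leq_ltn_trans (leq_pred _)).
    move: s0 (ltn_ord (shift_room succn k u j)); lia.
  by have := h1 j; rewrite ltnNge jk /= ffunE jk.
move/forallP=> du; congr (\det _); apply/matrixP => s i; rewrite !mxE.
congr (_ %:R); congr (nat_of_bool (lab _ == _)); apply/funext => j.
rewrite /room_vertex /= /bump /= add1n; have := du j; rewrite ltnS.
case: ifP => jk uj; first by rewrite shiftE // addnS addSn.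
rewrite ffunE jk (eqP uj) /L ![(p * M)%N]mulnC !divnMDl // !divn_small //;
  have := ltn_ord s; rewrite /p; lia.
Qed.

(** Inner doors cancel, first and last doors cancel away from the boundary, and
    the only surviving boundary doors are the rooms of the face where coordinate
    [k] is [M]. *)
Lemma sum_doors k : (k < d)%N -> room_count k.+1 = room_count k.
Proof.
move=> kd; rewrite /room_count (eq_bigr _ (fun u _ => det_room_mx k u)) exchange_big /=.
rewrite (bigD1 ord0) //= (bigD1 ord_max) //= [X in _ + (_ + X)]big1 ?addr0; last first.
  by move=> t /andP[t0 tm]; exact: sum_inner_door.
rewrite sum_first_door //.
rewrite [X in _ + X](_ : _ =
  \sum_(u | room_dom k.+1 u) \det (wall_mx k u)); last first.
  apply: eq_bigr => u _; congr (\det _); apply/matrixP => s i; rewrite !mxE.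
  by rewrite lift_max.
rewrite (bigID (room_dom k.+1)) /= addrAC.
rewrite (eq_bigl (room_dom k.+1)); last first.
  move=> u; rewrite andb_idl // => /forallP du; apply/forallP => j; apply/implyP => kj.
  by have := du j; rewrite ltnS leqNgt kj.
rewrite F2_addxx add0r (bigID (room_dom k)) /= [X in _ + X]big1 ?addr0; last first.
  move=> u /andP[/andP[/forallP wu]].
  rewrite !negb_forall => /existsP[j jP] /existsP[i iP].
  have topE (i' : 'I_d) : ~~ (u i' < L)%N -> u i' = L :> nat.
    by rewrite -leqNgt => Lu; apply/eqP; rewrite eqn_leq -ltnS ltn_ord.
  have {jP} [jk uj] : (j <= k)%N /\ u j = L :> nat.
    have := wu j; move: jP; rewrite ltnS.
    case: (leqP j k) => /= [jk uj _|_ /negbTE -> //].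
    by split=> //; exact: topE.
  move: jk; rewrite leq_eqVlt => /orP[/eqP jk|jk]; last exact: det_wall_hi jk uj.
  have := wu i; move: iP; case: (ltnP i k) => [ik /topE ui _|].
    exact: det_wall_hi ik ui.
  rewrite leq_eqVlt => /orP[/eqP ki|->]; last by move=> /negbTE ->.
  by rewrite (_ : i = j) ?uj ?eqxx //; apply: val_inj; rewrite /= -ki.
apply: eq_big => u; last by case/andP=> _; exact: det_wall_room.
rewrite andb_idl // => /forallP du; apply/andP; split.
  apply/forallP => j; apply/implyP => kj; have := du j.
  by rewrite ltnNge (ltnW kj).
apply/forallPn; exists (Ordinal kd); have := du (Ordinal kd).
by rewrite /= ltnn ltnS leqnn => /eqP ->; rewrite ltnn.
Qed.

Lemma exists_full_room : exists w : nat -> 'I_d -> nat,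
  [/\ forall t j, (t <= d)%N -> (w t j <= M)%N,
      forall s t j, (s <= d)%N -> (t <= d)%N -> (w s j <= (w t j).+1)%N &
      forall s t, (s <= d)%N -> (t <= d)%N -> lab (w s) = lab (w t) -> s = t].
Proof.
have : room_count d != 0.
  suff -> : room_count d = 1 by rewrite oner_eq0.
  elim: {-2}d (leqnn d) => [_|k IH kd]; last by rewrite sum_doors // IH // ltnW.
  rewrite /room_count (bigD1 [ffun=> ord_max]) /=; last first.
    by apply/forallP => j; rewrite ffunE.
  rewrite det_mx11 mxE ord1 eqxx big1 ?addr0 // => u /andP[/forallP du /negP[]].
  by apply/eqP/ffunP => j; apply: val_inj; rewrite ffunE /= (eqP (du j)).
have [[u det_u] _|h] := pselect (exists u, \det (room_mx d u) != 0); last first.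
  rewrite /room_count big1 ?eqxx // => u _; apply/eqP/negPn/negP => hu.
  by apply: h; exists u.
exists (room_vertex u); split=> [t j td|s t j sd td|s t sd td st].
- by apply: room_vertex_le; rewrite /p ltnS.
- have -> : (room_vertex u t j).+1 = ((u j + t + p) %/ p)%N.
    by rewrite divnDr ?dvdnn // divnn addn1.
  by apply: leq_div2r; rewrite /p; lia.
- apply/eqP/negPn/negP => nst; move/negP: det_u; apply; apply/eqP.
  rewrite -ltnS in sd; rewrite -ltnS in td.
  apply: (@determinant_alternate _ _ _ (Ordinal sd) (Ordinal td)) => [|i].
    by rewrite -(inj_eq val_inj).
  by rewrite !mxE /= st.
Qed.
End Kuhn.

(** Label a vertex by the first coordinate [i] such that its colour does not meet
    the face [v i = 0], and by [d] if there is none.  Then label [i] is absent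
    from that face, labels above [i] are absent from the opposite face, and
    vertices with different labels have different colours. *)
Lemma grid_coloring (C : Type) d M (col : ('I_d -> nat) -> C) :
  (forall v w (i : 'I_d), (forall j, v j <= M)%N -> (forall j, w j <= M)%N ->
     v i = 0%N -> w i = M -> col v <> col w) ->
  exists w : nat -> 'I_d -> nat,
  [/\ forall t j, (t <= d)%N -> (w t j <= M)%N,
      forall s t j, (s <= d)%N -> (t <= d)%N -> (w s j <= (w t j).+1)%N &
      forall s t, (s <= d)%N -> (t <= d)%N -> col (w s) = col (w t) -> s = t].
Proof.
move=> sep.
pose touches c (i : 'I_d) :=
  `[< exists v, [/\ forall j, (v j <= M)%N, v i = 0%N & col v = c] >].
pose lab v := find (fun i => ~~ touches (col v) i) (enum 'I_d).
have [v i vM vi||w [w1 w2 w3]] := @exists_full_room d M lab.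
- apply/eqP => labi.
  have : (lab v < size (enum 'I_d))%N by rewrite labi size_enum_ord.
  rewrite -has_find => /(nth_find i).
  rewrite -/(lab v) labi nth_ord_enum => /negP; apply.
  by apply/asboolP; exists v.
- move=> v i vM vi; rewrite leqNgt; apply/negP => /(before_find i).
  rewrite nth_ord_enum => /negbFE /asboolP[v' [v'M v'i]].
  by apply: sep vi.
- by exists w; split=> // s t sd td st; apply: w3 => //; rewrite /lab st.
Qed.

(** * Convex combinations in CAT(0) spaces *)

Section Plane.
Context {R : realType}.

Definition plane_point (a b : R) : 'rV[R]_2 := \row_(i < 2) [:: a; b]`_i.

Lemma plane_dist (a b a' b' : R) :
  euclidean_dist (plane_point a b) (plane_point a' b') =
  Num.sqrt ((a - a') ^+ 2 + (b - b') ^+ 2).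
Proof. by rewrite /euclidean_dist !big_ord_recl big_ord0 addr0 !mxE. Qed.

Lemma plane_comb (t a b a' b' : R) :
  (1 - t) *: plane_point a b + t *: plane_point a' b' =
  plane_point ((1 - t) * a + t * a') ((1 - t) * b + t * b').
Proof. by apply/rowP => i; rewrite !mxE; case: i => [[|[|i]] //= ?]. Qed.

Lemma euclidean_distC (u v : 'rV[R]_2) : euclidean_dist u v = euclidean_dist v u.
Proof.
by congr Num.sqrt; apply: eq_bigr => i _; rewrite -sqrrN opprB.
Qed.

Lemma euclidean_distvv (u : 'rV[R]_2) : euclidean_dist u u = 0.
Proof.
by rewrite /euclidean_dist big1 ?sqrtr0 // => i _; rewrite subrr expr0n.
Qed.

Lemma euclidean_dist_scale (u v u' v' : 'rV[R]_2) (s : R) :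
  0 <= s -> u - v = s *: (u' - v') ->
  euclidean_dist u v = s * euclidean_dist u' v'.
Proof.
move=> s0 uv; rewrite -{1}(ger0_norm s0) -sqrtr_sqr -sqrtrM ?sqr_ge0 //.
congr Num.sqrt; rewrite mulr_sumr; apply: eq_bigr => i _.
by have := congr1 (fun w : 'rV_2 => w 0 i) uv; rewrite !mxE => ->; rewrite exprMn.
Qed.

(** With the first side on the horizontal axis, the law of cosines gives the
    abscissa of the third vertex, and the triangle inequalities say that its
    ordinate is the square root of a nonnegative number. *)
Lemma exists_comparison_triangle (a b c : R) : 0 <= a -> 0 <= b -> 0 <= c ->
  c <= a + b -> a <= b + c -> b <= a + c ->
  exists w0 w1 w2 : 'rV[R]_2, [/\ euclidean_dist w0 w1 = a,
    euclidean_dist w0 w2 = b & euclidean_dist w1 w2 = c].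
Proof.
move=> a0 b0 c0 cab abc bac.
have [az|an0] := eqVneq a 0.
  subst a.
  exists 0, 0, (plane_point b 0); have -> : 0 = plane_point 0 0 :> 'rV[R]_2.
    by apply/rowP => i; rewrite !mxE; case: i => [[|[|i]] //= ?].
  have -> : c = b by lra.
  rewrite !plane_dist; have -> : (0 - b) ^+ 2 + (0 - 0) ^+ 2 = b ^+ 2 by ring.
  by rewrite sqrtr_sqr ger0_norm // subrr expr0n addr0 sqrtr0.
pose u := (a ^+ 2 + b ^+ 2 - c ^+ 2) / (a *+ 2).
have ua : a *+ 2 * u = a ^+ 2 + b ^+ 2 - c ^+ 2.
  by rewrite /u mulrC divfK // mulrn_eq0.
have agt0 : 0 < a by rewrite lt_def an0.
have ub : 0 <= b ^+ 2 - u ^+ 2.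
  have -> : b ^+ 2 - u ^+ 2 = (b - u) * (b + u) by ring.
  rewrite -(pmulr_rge0 _ (x := (a *+ 2) ^+ 2)) ?exprn_gt0 ?mulrn_wgt0 //.
  have -> : (a *+ 2) ^+ 2 * ((b - u) * (b + u)) = 
    ((a *+ 2) * b - (a *+ 2 * u)) * ((a *+ 2) * b + (a *+ 2 * u)) by ring.
  rewrite ua.
  have -> : (a *+ 2) * b - (a ^+ 2 + b ^+ 2 - c ^+ 2) =
    (c - a + b) * (c + a - b) by ring.
  have -> : (a *+ 2) * b + (a ^+ 2 + b ^+ 2 - c ^+ 2) =
    (a + b - c) * (a + b + c) by ring.
  by rewrite !mulr_ge0 //; lra.
exists (plane_point 0 0), (plane_point a 0),
  (plane_point u (Num.sqrt (b ^+ 2 - u ^+ 2))).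
rewrite !plane_dist; split.
- have -> : (0 - a) ^+ 2 + (0 - 0) ^+ 2 = a ^+ 2 by ring.
  by rewrite sqrtr_sqr ger0_norm.
- rewrite sub0r sqrrN sub0r sqrrN sqr_sqrtr //.
  have -> : u ^+ 2 + (b ^+ 2 - u ^+ 2) = b ^+ 2 by ring.
  by rewrite sqrtr_sqr ger0_norm.
- rewrite sub0r sqrrN sqr_sqrtr //.
  have -> : (a - u) ^+ 2 + (b ^+ 2 - u ^+ 2) =
    a ^+ 2 - a *+ 2 * u + b ^+ 2 by ring.
  rewrite ua.
  have -> : a ^+ 2 - (a ^+ 2 + b ^+ 2 - c ^+ 2) + b ^+ 2 = c ^+ 2 by ring.
  by rewrite sqrtr_sqr ger0_norm.
Qed.

End Plane.

Section Geodesics.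
Context {R : realType} {X : metricType R}.
Hypothesis catX : CAT0 X.
Implicit Types (x y z p : X) (s t : R).

Lemma geodesic_segmentC x y S :
  geodesic_segment x y S -> geodesic_segment y x S.
Proof.
move=> [c [[c0 c1 cd] ->]]; exists (fun t => c (mdist x y - t)).
rewrite /is_geodesic (metric_sym y x) subr0 subrr; split; first split => //.
  move=> s t; rewrite !in_itv /= => /andP[s0 s1] /andP[t0 t1].
  rewrite cd ?in_itv /= ?subr_ge0 ?gerBl ?s0 ?s1 ?t0 ?t1 //.
  by rewrite [RHS]distrC; congr `| _ |; ring.
apply/seteqP; split=> y' [t] /=; rewrite in_itv /= => /andP[t0 t1] <-;
  exists (mdist x y - t) => //=; rewrite ?in_itv /= ?subr_ge0 ?gerBl ?t0 ?t1 //.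
by congr c; ring.
Qed.

Lemma geodesic_segment_point x : geodesic_segment x x [set x].
Proof.
exists (fun=> x); rewrite /is_geodesic mdistxx; split; first split => //.
  move=> s t; rewrite !in_itv /= -!eq_le => /eqP <- /eqP <-.
  by rewrite subrr normr0.
apply/seteqP; split=> [y -> | y [t _ <-] //]; exists 0 => //=.
by rewrite in_itv /= lexx.
Qed.

(** All later comparisons use two sides with a common end point [x]; the third
    side of the triangle can then be any segment. *)
Lemma CAT0_ineq x y z c c' w0 w1 w2 s t :
  is_geodesic c x y -> is_geodesic c' x z ->
  euclidean_dist w0 w1 = mdist x y -> euclidean_dist w0 w2 = mdist x z ->
  euclidean_dist w1 w2 = mdist y z -> 0 <= s <= 1 -> 0 <= t <= 1 ->
  mdist (c (s * mdist x y)) (c' (t * mdist x z)) <=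
  euclidean_dist ((1 - s) *: w0 + s *: w1) ((1 - t) *: w0 + t *: w2).
Proof.
move=> gc gc' d01 d02 d12 s01 t01.
have [S12 gS12] := catX.1 y z.
pose S01 := c @` `[0, mdist x y]; pose S02 := c' @` `[0, mdist x z].
pose v (i : 'I_3) := nth x [:: x; y; z] i.
pose w (i : 'I_3) := nth w0 [:: w0; w1; w2] i.
pose side (i j : 'I_3) :=
  if i == j then [set v i] else nth set0 [:: set0; S01; S02; S12] (i + j).
pose i0 : 'I_3 := @Ordinal 3 0 isT.
pose i1 : 'I_3 := @Ordinal 3 1 isT.
pose i2 : 'I_3 := @Ordinal 3 2 isT.
have gS01 : geodesic_segment x y S01 by exists c.
have gS02 : geodesic_segment x z S02 by exists c'.
have tri : geodesic_triangle v side.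
  split=> [i j|i j]; last first.
    by rewrite /side eq_sym addnC; case: eqVneq => // ->.
  rewrite /side; case: eqVneq => [->|]; first exact: geodesic_segment_point.
  by case: i j => [[|[|[|i]]] // ?] [[|[|[|j]]] // ?] //= _; rewrite /v /= //;
     apply: geodesic_segmentC.
have cmp : comparison_triangle v w.
  move=> i j; case: i j => [[|[|[|i]]] // ?] [[|[|[|j]]] // ?]; rewrite /v /w /=;
    rewrite ?mdistxx ?euclidean_distvv // euclidean_distC metric_sym //.
have pt x' y' c'' u u' r : is_geodesic c'' x' y' ->
    euclidean_dist u u' = mdist x' y' -> 0 <= r <= 1 ->
   [/\ (c'' @` `[0, mdist x' y']) (c'' (r * mdist x' y')),
      euclidean_segment u u' ((1 - r) *: u + r *: u') &
      euclidean_dist u ((1 - r) *: u + r *: u') = mdist x' (c'' (r * mdist x' y'))].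
  move=> [g0 g1 gd] uu /andP[r0 r1].
  have rin : 0 <= r * mdist x' y' <= mdist x' y'.
    by rewrite mulr_ge0 ?mdist_ge0 //= ler_piMl ?mdist_ge0.
  split.
  - by exists (r * mdist x' y') => //=; rewrite in_itv.
  - by exists r => //=; rewrite in_itv /= r0.
  - rewrite -{1}g0 gd ?in_itv //= ?lexx ?mdist_ge0 // sub0r normrN.
    rewrite ger0_norm; last by case/andP: rin.
    rewrite -uu; apply: euclidean_dist_scale => //.
    by apply/rowP => i; rewrite !mxE; ring.
have [p1 p2 p3] := pt _ _ _ _ _ _ gc d01 s01.
have [q1 q2 q3] := pt _ _ _ _ _ _ gc' d02 t01.
by apply: (catX.2 v side w tri cmp i0 i1 i0 i2).
Qed.

Lemma geodesic_dist c x y s : is_geodesic c x y -> 0 <= s <= 1 ->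
  mdist x (c (s * mdist x y)) = s * mdist x y /\
  mdist (c (s * mdist x y)) y = (1 - s) * mdist x y.
Proof.
move=> [c0 c1 cd] /andP[s0 s1]; have D0 := mdist_ge0 x y.
have sin : s * mdist x y \in `[0, mdist x y].
  by rewrite in_itv /= mulr_ge0 //= ler_piMl.
have zin : 0 \in `[0, mdist x y] by rewrite in_itv /= lexx.
have Din : mdist x y \in `[0, mdist x y] by rewrite in_itv /= lexx D0.
split.
  by rewrite -{1}c0 cd // sub0r normrN ger0_norm // mulr_ge0.
rewrite -{2}c1 cd // distrC ger0_norm; first by rewrite mulrBl mul1r.
by rewrite subr_ge0 ler_piMl.
Qed.

Lemma exists_geodesic x y : exists c, is_geodesic c x y.
Proof. by have [S [c [gc _]]] := catX.1 x y; exists c. Qed.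

(** Comparison in the degenerate triangle with vertices [x], [p] and [y]: the
    comparison points of [p] and of the point of the geodesic coincide. *)
Lemma geodesic_unique c x y p s : is_geodesic c x y -> 0 <= s <= 1 ->
  mdist x p = s * mdist x y -> mdist p y = (1 - s) * mdist x y ->
  c (s * mdist x y) = p.
Proof.
move=> gc s01 dxp dpy; have [c' gc'] := exists_geodesic x p.
have /andP[s0 s1] := s01; have D0 := mdist_ge0 x y.
apply/esym/mdist_positivity/eqP; rewrite eq_le mdist_ge0 andbT.
pose w0 : 'rV[R]_2 := plane_point 0 0.
pose w1 : 'rV[R]_2 := plane_point (s * mdist x y) 0.
pose w2 : 'rV[R]_2 := plane_point (mdist x y) 0.
have E : c' (1 * mdist x p) = p by rewrite mul1r; case: gc'.
rewrite -{1}E.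
have planeE a b : 0 <= b - a ->
    euclidean_dist (plane_point a 0) (plane_point b 0) = b - a :> R.
  by move=> ab; rewrite plane_dist subrr expr0n addr0 sqrtr_sqr distrC ger0_norm.
have h01 : euclidean_dist w0 w1 = mdist x p by rewrite planeE ?subr0 // mulr_ge0.
have h02 : euclidean_dist w0 w2 = mdist x y by rewrite planeE subr0.
have h12 : euclidean_dist w1 w2 = mdist p y.
  by rewrite planeE ?dpy; [ring | rewrite subr_ge0 ler_piMl].
have s1' : 0 <= (1 : R) <= 1 by rewrite ler01 lexx.
apply: le_trans (CAT0_ineq gc' gc h01 h02 h12 s1' s01) _.
rewrite !plane_comb plane_dist.
have -> : 1 - 1 = 0 :> R by ring.
rewrite [X in X ^+ 2 + _](_ : _ = 0); last by ring.
rewrite [X in _ + X ^+ 2](_ : _ = 0); last by ring.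
by rewrite expr0n addr0 sqrtr0.
Qed.

(** The point at fraction [s] of the segment from [x] to [y].  It is specified
    by its distances to the end points, so that symmetry and equivariance under
    isometries follow from uniqueness. *)
Definition comb x y s : X :=
  xget x [set p | mdist x p = s * mdist x y /\ mdist p y = (1 - s) * mdist x y].

Lemma comb_geodesic c x y s : is_geodesic c x y -> 0 <= s <= 1 ->
  comb x y s = c (s * mdist x y).
Proof.
move=> gc s01; rewrite /comb; case: xgetP => [p _ [h1 h2]|/(_ (c (s * mdist x y)))].
  by rewrite (geodesic_unique gc s01 h1 h2).
by case; exact: geodesic_dist.
Qed.

Lemma comb_dist x y s : 0 <= s <= 1 ->
  mdist x (comb x y s) = s * mdist x y /\
  mdist (comb x y s) y = (1 - s) * mdist x y.
Proof.
move=> s01; have [c gc] := exists_geodesic x y.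
by rewrite (comb_geodesic gc s01); exact: geodesic_dist.
Qed.

Lemma comb_unique x y p s : 0 <= s <= 1 ->
  mdist x p = s * mdist x y -> mdist p y = (1 - s) * mdist x y ->
  comb x y s = p.
Proof.
move=> s01 h1 h2; have [c gc] := exists_geodesic x y.
by rewrite (comb_geodesic gc s01); exact: geodesic_unique.
Qed.

Lemma comb0 x y : comb x y 0 = x.
Proof.
by apply: comb_unique; rewrite ?lexx ?ler01 // ?mdistxx ?mul0r // subr0 mul1r.
Qed.

Lemma comb1 x y : comb x y 1 = y.
Proof.
by apply: comb_unique; rewrite ?lexx ?ler01 // ?mdistxx ?mul1r // subrr mul0r.
Qed.

Lemma combC x y s : 0 <= s <= 1 -> comb y x (1 - s) = comb x y s.
Proof.
move=> s01; have [h1 h2] := comb_dist x y s01; apply: comb_unique.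
- by move: s01 => /andP[s0 s1]; rewrite subr_ge0 s1 gerBl s0.
- by rewrite metric_sym h2 (metric_sym x).
- by rewrite metric_sym h1 (metric_sym x); congr (_ * _); ring.
Qed.

Lemma comb_isometry (g : X -> X) x y s :
  (forall a b, mdist (g a) (g b) = mdist a b) -> 0 <= s <= 1 ->
  g (comb x y s) = comb (g x) (g y) s.
Proof.
move=> gP s01; have [h1 h2] := comb_dist x y s01.
by apply/esym/comb_unique; rewrite ?gP.
Qed.

Lemma comb_dist_param x y s t : 0 <= s <= 1 -> 0 <= t <= 1 ->
  mdist (comb x y s) (comb x y t) = `|s - t| * mdist x y.
Proof.
move=> s01 t01; have [c gc] := exists_geodesic x y.
rewrite !(comb_geodesic gc) //; case: gc => _ _ cd.
have D0 := mdist_ge0 x y.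
rewrite cd -?mulrBl ?normrM ?(ger0_norm D0) // in_itv /=.
  by case/andP: s01 => s0 s1; rewrite mulr_ge0 //= ler_piMl.
by case/andP: t01 => s0 s1; rewrite mulr_ge0 //= ler_piMl.
Qed.

Lemma comb_thin x y z s : 0 <= s <= 1 ->
  mdist (comb x y s) (comb x z s) <= s * mdist y z.
Proof.
move=> s01; have [c gc] := exists_geodesic x y; have [c' gc'] := exists_geodesic x z.
rewrite (comb_geodesic gc) // (comb_geodesic gc') //.
have [w0 [w1 [w2 [h01 h02 h12]]]] : exists w0 w1 w2 : 'rV[R]_2,
    [/\ euclidean_dist w0 w1 = mdist x y, euclidean_dist w0 w2 = mdist x z &
        euclidean_dist w1 w2 = mdist y z].
  apply: exists_comparison_triangle; rewrite ?mdist_ge0 //.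
  - by rewrite (metric_sym x y) metric_triangle.
  - by rewrite (metric_sym y z) metric_triangle.
  - exact: metric_triangle.
apply: le_trans (CAT0_ineq gc gc' h01 h02 h12 s01 s01) _.
rewrite -h12 (@euclidean_dist_scale _ _ _ w1 w2 s) //; first by case/andP: s01.
by apply/rowP => i; rewrite !mxE; ring.
Qed.

(** Insert the diagonal from [x] to [y'] and apply [comb_thin] to both
    triangles. *)
Lemma comb_convex x y x' y' s : 0 <= s <= 1 ->
  mdist (comb x y s) (comb x' y' s) <= (1 - s) * mdist x x' + s * mdist y y'.
Proof.
move=> s01; have s01' : 0 <= 1 - s <= 1.
  by move: s01 => /andP[s0 s1]; rewrite subr_ge0 s1 gerBl s0.
apply: le_trans (metric_triangle _ (comb x y' s) _) _; rewrite addrC.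
by apply: lerD; [rewrite -!(combC _ _ s01) |]; exact: comb_thin.
Qed.

End Geodesics.

(** * Axes of isometries with minimal displacement *)

Section Axis.
Context {R : realType} {X : metricType R} {G : zmodType}.
Variable act : G -> X -> X.
Hypothesis catX : CAT0 X.
Hypothesis actP : isometric_action act.
Implicit Types (g : G) (x y : X).

Lemma act_dist g x y : mdist (act g x) (act g y) = mdist x y.
Proof. by case: actP => _ _ /(_ g)[_]. Qed.

Lemma act0 x : act 0 x = x. Proof. by case: actP. Qed.

Lemma actD g h x : act (g + h) x = act g (act h x). Proof. by case: actP. Qed.

(** For the midpoint [m] of the segment from [h y] to [y], the segment from [m]
    to [h m] joins the midpoints of two sides of the triangle with vertices [y],
    [h y] and [h (h y)], so it is at most half as long as the third side. *)
Lemma displacement_square (h : X -> X) (a : R) :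
  (forall x y, mdist (h x) (h y) = mdist x y) ->
  (forall y, a <= mdist y (h y)) ->
  forall y, a *+ 2 <= mdist y (h (h y)).
Proof.
move=> hP ha y; have half01 : 0 <= (2^-1 : R) <= 1.
  by rewrite invr_ge0 ler0n invf_le1 ?ltr0n ?ler1n.
pose m := comb (h y) y 2^-1.
have hm : h m = comb (h y) (h (h y)) 2^-1.
  rewrite /m comb_isometry // -(combC catX _ _ half01); congr comb.
  by rewrite [X in X - _](splitr 1) mul1r addrK.
have thin : a <= 2^-1 * mdist y (h (h y)).
  by apply: le_trans (ha m) _; rewrite hm; exact: comb_thin.
by rewrite mulr2n; lra.
Qed.

Lemma displacement_pow2 g (a : R) : (forall y, a <= mdist y (act g y)) ->
  forall k y, a *+ (2 ^ k) <= mdist y (act (g *+ (2 ^ k)) y).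
Proof.
move=> ha; elim=> [|k IH] y; first by rewrite expn0 !mulr1n.
rewrite expnS mulnC !mulrnA [X in act X]mulr2n actD.
by apply: displacement_square => // x z; rewrite act_dist.
Qed.

Section Line.
Variables (g : G) (x : X).
Hypothesis min_x : forall y, mdist x (act g x) <= mdist y (act g y).
Let a := mdist x (act g x).
Let P (m : int) := act (g *~ m) x.

(** The concatenation of the translates of the segment from [x] to [act g x],
    with each of them parametrized by an interval of length 1. *)
Definition axis (t : R) : X :=
  act (g *~ Num.floor t) (comb x (act g x) (t - (Num.floor t)%:~R)).

Lemma axis_frac (t : R) : 0 <= t - (Num.floor t)%:~R <= 1.
Proof.
have /andP[h1 h2] := floor_itv t; rewrite subr_ge0 h1 /=.
by move: h2; rewrite intrD => /ltW; lra.
Qed.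

Lemma orbit_dist_le (m : int) (n : nat) : mdist (P m) (P (m + n%:Z)) <= n%:R * a.
Proof.
elim: n => [|n IH]; first by rewrite addr0 mdistxx mul0r.
apply: le_trans (metric_triangle _ (P (m + n%:Z)) _) _.
rewrite mulrSr mulrDl mul1r lerD // -addn1 PoszD addrA /P.
rewrite [in X in mdist _ X]mulrzDr actD.
by rewrite act_dist mulr1z.
Qed.

Lemma axis_int (m : int) : axis m%:~R = P m.
Proof. by rewrite /axis intrKfloor subrr (comb0 catX). Qed.

Lemma axisD1 (t : R) : axis (t + 1) = act g (axis t).
Proof.
rewrite /axis floorDrz ?int_num1 // floor1 -actD.
have -> : g + g *~ Num.floor t = g *~ (Num.floor t + 1).
  by rewrite mulrzDr mulr1z addrC.
by congr (act _ (comb _ _ _)); rewrite intrD; ring.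
Qed.

Lemma axis_dist_le s t : s <= t -> mdist (axis s) (axis t) <= (t - s) * a.
Proof.
move=> st; have fst := le_floor st.
have [fE|fN] := eqVneq (Num.floor s) (Num.floor t).
  rewrite /axis fE act_dist comb_dist_param -?fE ?axis_frac //; last first.
    by rewrite fE axis_frac.
  rewrite -/a distrC ger0_norm; last by lra.
  by rewrite (_ : t - _ - _ = t - s) //; ring.
have {fN fst} flt : Num.floor s < Num.floor t by rewrite lt_neqAle fN fst.
have [n nE] : exists n : nat, Num.floor t = Num.floor s + 1 + n%:Z.
  exists `|(Num.floor t - (Num.floor s + 1))%R|%N.
  by rewrite gez0_abs ?subr_ge0 ?lezD1 // addrC subrK.
apply: le_trans (metric_triangle _ (P (Num.floor s + 1)) _) _.
apply: le_trans (lerD (lexx _) (metric_triangle _ (P (Num.floor t)) _)) _.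
have h1 : mdist (axis s) (P (Num.floor s + 1)) = (1 - (s - (Num.floor s)%:~R)) * a.
  rewrite /axis /P mulrzDr actD act_dist mulr1z.
  by have [_ ->] := comb_dist catX x (act g x) (axis_frac s).
have h2 : mdist (P (Num.floor t)) (axis t) = (t - (Num.floor t)%:~R) * a.
  rewrite /axis /P act_dist.
  by have [-> _] := comb_dist catX x (act g x) (axis_frac t).
have := orbit_dist_le (Num.floor s + 1) n; rewrite -nE => h3.
apply: le_trans (lerD (lexx _) (lerD h3 (lexx _))) _; rewrite h1 h2 nE.
by rewrite !intrD -pmulrn; lra.
Qed.

(** The upper bound holds along any concatenation of segments.  It is attained,
    because [act (g *+ 2 ^ k)] moves every point by at least [2 ^ k * a], so that
    a long piece of the axis containing both parameters is as long as the
    distance between its end points. *)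
Lemma axis_dist s t : mdist (axis s) (axis t) = `|s - t| * a.
Proof.
wlog st : s t / s <= t => [H|].
  by have [/H//|/ltW/H] := leP s t; rewrite metric_sym distrC.
rewrite distrC ger0_norm ?subr_ge0 //; apply/eqP; rewrite eq_le axis_dist_le //=.
pose k := Num.bound (`|s| + `|t|); pose N : int := (2 ^ k)%N.
have kN : `|s| + `|t| < N%:~R.
  apply: lt_le_trans (archi_boundP _) _; first by rewrite addr_ge0.
  by rewrite -pmulrn ler_nat ltnW // ltn_expl.
have [s1 s2] : - N%:~R <= s /\ t <= N%:~R.
  have := ler_norm t; have := ler_norm (- s); rewrite normrN.
  by have := normr_ge0 s; have := normr_ge0 t; lra.
have far : N%:~R * a *+ 2 <= mdist (P (- N)) (P N).
  have := displacement_pow2 min_x k.+1 (P (- N)); rewrite -/a.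
  have -> : act (g *+ 2 ^ k.+1) (P (- N)) = P N.
    rewrite /P -actD -[g *+ _]/(g *~ (2 ^ k.+1)%N) -mulrzDr; congr (act (_ *~ _) _).
    by rewrite expnS mul2n -addnn PoszD addrK.
  by rewrite expnS mulnC mulrnA -[a *+ (2 ^ k)]mulr_natl /N -pmulrn.
have := metric_triangle (P (- N)) (axis s) (P N).
have := metric_triangle (axis s) (axis t) (P N).
have := axis_dist_le s1; have := axis_dist_le s2.
rewrite -[- N%:~R]mulrNz !axis_int.
have a0 : 0 <= a := mdist_ge0 _ _.
rewrite mulrNz; nra.
Qed.

Lemma min_displacement_semi_simple : semi_simple (act g).
Proof.
have [a0|an0] := eqVneq a 0; first by left; exists x; apply/esym/mdist_positivity.
have agt0 : 0 < a by rewrite lt_def an0 mdist_ge0.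
right; exists (fun t => axis (t / a)); split.
  move=> s t; rewrite axis_dist -mulrBl normrM normfV (ger0_norm (ltW agt0)).
  by rewrite divfK.
by exists a => // t; rewrite -axisD1 mulrDl divff.
Qed.
End Line.
End Axis.

(** * Covering dimension and compactness in proper spaces *)

Section ProperSpaces.
Context {R : realType} {X : metricType R}.
Hypothesis properX : proper_space X.
Implicit Types (x y : X).

Lemma near_mdist x (P : X -> Prop) (r : R) : 0 < r ->
  (forall y, mdist x y < r -> P y) -> \forall y \near x, P y.
Proof. by move=> r0 h; apply/metricType_numDomainType.nbhs_mdistP; exists r. Qed.

Lemma open_mdist_ball x (r : R) : open [set y | mdist x y < r].
Proof.
rewrite openE => y /= xy; rewrite /interior.
apply: (@near_mdist _ _ (r - mdist x y)); first by rewrite subr_gt0.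
by move=> z yz; apply: le_lt_trans (metric_triangle _ y _) _; rewrite -ltrBrDl.
Qed.

Lemma lebesgue_number x (r : R) (V : set (set X)) : open_cover V ->
  exists2 lam : R, 0 < lam & forall y, mdist x y <= r ->
    exists2 B, V B & forall z, mdist y z < lam -> B z.
Proof.
move=> [Vo Vc].
pose P (e : R) (y : X) := exists2 B, V B & forall z, mdist y z < e -> B z.
have /compact_near_coveringP/(_ R (0^'+) P) := @properX x r.
case=> [|e /= e0 sub]; last first.
  exists (e / 2); first by rewrite divr_gt0.
  apply: sub; rewrite /= ?sub0r ?normrN ?gtr0_norm ?divr_gt0 //.
  by rewrite ltr_pdivrMr // ltr_pMr // ltr1n.
move=> y _; have : (\bigcup_(A in V) A) y by rewrite Vc.
case=> B VB By; have := Vo _ VB; rewrite openE => /(_ _ By).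
move=> /metricType_numDomainType.nbhs_mdistP[e /= e0 eB].
exists ([set z | mdist y z < e / 2], [set s | s < e / 2]) => /=.
  split.
    apply/metricType_numDomainType.nbhs_mdistP.
    by exists (e / 2) => //=; rewrite divr_gt0.
  exists (e / 2) => /=; first by rewrite divr_gt0.
  by move=> s /= + s0; rewrite sub0r normrN gtr0_norm.
move=> [z s] /= [yz se]; exists B => // z' zz'; apply: eB => /=.
by apply: le_lt_trans (metric_triangle _ z _) _; lra.
Qed.

Lemma min_displacement_ball (h : X -> X) x (r : R) : 0 <= r ->
  (forall a b, mdist (h a) (h b) = mdist a b) ->
  exists y, forall z, mdist x z <= r -> mdist y (h y) <= mdist z (h z).
Proof.
move=> r0 hP.
have [|||y _ ymin] := @compact_EVT_min X R (fun y => mdist y (h y))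
  (metric_closed_ball x r).
- by exists x; rewrite /metric_closed_ball /= mdistxx.
- exact: @properX.
- apply: continuous_subspaceT => y; apply/cvgrPdist_lt => e e0.
  apply: (@near_mdist _ _ (e / 2)); first by rewrite divr_gt0.
  move=> z yz; have := hP y z.
  have := metric_triangle y z (h y); have := metric_triangle z (h z) (h y).
  have := metric_triangle z y (h z); have := metric_triangle y (h y) (h z).
  rewrite (metric_sym (h z) (h y)) (metric_sym z y) => *.
  by rewrite ltr_norml; lra.
- by exists y => z xz; apply: ymin; rewrite inE.
Qed.

(** A refinement of the cover by balls of radius [e / 2] has a Lebesgue number
    [lam] on the ball that contains the grids.  Colour a vertex [v] by a member
    containing the ball of radius [lam] about [F v]: no colour meets opposite
    faces, and each colour of a unit cube contains the image of every vertex of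
    that cube. *)
Lemma refinement_order_gt (k d : nat) x (r e : R) :
  0 < e -> has_refinements_of_order X k ->
  (forall lam : R, 0 < lam -> exists (M : nat) (F : ('I_d -> nat) -> X),
    [/\ forall v, (forall j, v j <= M)%N -> mdist x (F v) <= r,
        forall v w, (forall j, v j <= M)%N -> (forall j, w j <= M)%N ->
          (forall j, v j <= (w j).+1)%N -> (forall j, w j <= (v j).+1)%N ->
          mdist (F v) (F w) < lam &
        forall v w (i : 'I_d), (forall j, v j <= M)%N -> (forall j, w j <= M)%N ->
          v i = 0%N -> w i = M -> e <= mdist (F v) (F w)]) ->
  (d < k)%N.
Proof.
move=> e0 refk exF.
pose U := [set [set z | mdist y z < e / 2] | y in [set: X]].
have [|V [Vcov VU Vk]] := refk U.
  split; first by move=> _ [y _ <-]; exact: open_mdist_ball.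
  apply/seteqP; split=> // y _; exists [set z | mdist y z < e / 2]; first by exists y.
  by rewrite /= mdistxx divr_gt0.
have [lam lam0 lamP] := lebesgue_number x r Vcov.
have [M [F [Fr Fnear Ffar]]] := exF _ lam0.
pose good v B := V B /\ forall z, mdist (F v) z < lam -> B z.
pose col v : set X := xget set0 (good v).
have colP v : (forall j, v j <= M)%N -> good v (col v).
  move=> vM; rewrite /col; case: xgetP => [B _ //|h].
  by have [B VB Bz] := lamP _ (Fr _ vM); case: (h B).
have [|w [wM wadj winj]] := @grid_coloring _ d M col.
  move=> v w i vM wM vi wi vw.
  have [VB hB] := colP _ vM; have [_ hB'] := colP _ wM.
  have [_ [y _ <-] BA] := VU _ VB.
  have /BA /= yv : col v (F v) by apply: hB; rewrite mdistxx.
  have /BA /= yw : col v (F w) by rewrite vw; apply: hB'; rewrite mdistxx.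
  have := Ffar _ _ _ vM wM vi wi; apply/negP; rewrite -ltNge.
  apply: le_lt_trans (metric_triangle _ y _) _; rewrite metric_sym.
  by rewrite [ltRHS](splitr e) ltrD.
have sub : (fun t => col (w t)) @` `I_d.+1 `<=` [set B | V B /\ B (F (w 0%N))].
  move=> _ [t /= td <-]; have tM j : (w t j <= M)%N by apply: wM.
  have [VB hB] := colP _ tM; split => //; apply: hB.
  by apply: Fnear => // j; [apply: wM | apply: wadj | apply: wadj].
have inj : {in `I_d.+1 &, injective (fun t => col (w t))}.
  by move=> s t; rewrite !inE => /= sd td; exact: winj.
have := card_le_trans (subset_card_le sub) (Vk _).
by rewrite (card_le_eql (inj_card_eq inj)) card_le_II.
Qed.

End ProperSpaces.

Section ProperActions.
Context {R : realType} {X : metricType R} {G : zmodType}.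
Variable act : G -> X -> X.
Hypotheses (properX : proper_space X) (actP : isometric_action act).
Hypothesis act_proper : proper_action act.

(** If infinitely many [g] moved [x] into the ball, their images of [x] would
    accumulate at some [y]; the differences of such [g] would then be infinitely
    many elements moving a small ball about [y] onto one that meets it. *)
Lemma finite_orbit_ball x (r : R) : finite_set [set g | mdist x (act g x) <= r].
Proof.
pose F : set_system G := [set U | finite_set (~` U)].
have FF : Filter F.
  split.
  - by rewrite /F /mkset setCT.
  - by move=> A B; rewrite /F /mkset setCI finite_setU.
  - by move=> A B AB; apply: sub_finite_set; exact: subsetC.
have /compact_near_coveringP/(_ G F (fun g y => act g x <> y) FF) := @properX x r.
case=> [y _|m Ffin]; last first.
  have {}Ffin : finite_set
      (~` [set g | metric_closed_ball x r `<=` [set y | act g x <> y]]).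
    by exists m.
  by apply: sub_finite_set Ffin => g /= gr /(_ _ gr); exact.
have [s s0 fin] := act_proper y.
exists ([set z | mdist y z < s], [set g | ~ mdist y (act g x) < s]) => /=; last first.
  by move=> [z g] /= [yz gs] gz; apply: gs; rewrite gz.
split; first by apply/metricType_numDomainType.nbhs_mdistP; exists s.
rewrite /F /=.
have [[h hs]|none] := pselect (exists h, mdist y (act h x) < s); last first.
  apply: (@sub_finite_set _ _ set0) => // g /= /contrapT gs.
  by apply: none; exists g.
apply: sub_finite_set (finite_image (fun g => g + h) fin) => g /= /contrapT gs.
exists (g - h); last by rewrite subrK.
exists (act g x); split => /=; last exact: ltW.
exists (act h x); first exact: ltW.
by rewrite -actD // subrK.
Qed.
End ProperActions.

(** * Maps of integer grids into CAT(0) spaces *)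

Section Interpolation.
Context {R : realType} {X : metricType R} (catX : CAT0 X).
Variables (n Q : nat) (Q_gt0 : (0 < Q)%N).
Implicit Types (v w z : 'I_n -> nat).

Definition upd z (i : 'I_n) (m : nat) : 'I_n -> nat :=
  fun j => if j == i then m else z j.

(** The broken geodesic through the points [p m], subdivided into [Q] steps
    between successive points. *)
Definition grid_path (p : nat -> X) (k : nat) : X :=
  comb (p (k %/ Q)%N) (p (k %/ Q).+1) ((k %% Q)%:R / Q%:R).

(** Interpolates [phi] in the coordinates listed in [s], which are read from [v]
    in units of [1 / Q]; the other coordinates are taken from [z]. *)
Fixpoint interp (phi : ('I_n -> nat) -> X) (s : seq 'I_n) v z : X :=
  if s is i :: s' then grid_path (fun m => interp phi s' v (upd z i m)) (v i)
  else phi z.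

Lemma frac01 k : 0 <= ((k %% Q)%:R / Q%:R : R) <= 1.
Proof.
rewrite divr_ge0 //= ler_pdivrMr ?ltr0n // mul1r ler_nat.
by rewrite ltnW // ltn_pmod.
Qed.

Lemma updC z i j a b : i != j -> upd (upd z i a) j b = upd (upd z j b) i a.
Proof.
move=> ij; apply/funext => l; rewrite /upd.
by case: eqVneq => // ->; rewrite eq_sym (negbTE ij).
Qed.

Lemma grid_path_step (p : nat -> X) (L : R) k :
  (forall m, mdist (p m) (p m.+1) <= L) ->
  mdist (grid_path p k) (grid_path p k.+1) <= L / Q%:R.
Proof.
move=> pL; have Q0 : 0 < Q%:R :> R by rewrite ltr0n.
have -> : grid_path p k.+1 =
    comb (p (k %/ Q)%N) (p (k %/ Q).+1) ((k %% Q).+1%:R / Q%:R).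
  rewrite /grid_path divnS // modnS; case: ifP => // kQ.
  have -> : (k %% Q).+1 = Q.
    have := divn_eq k.+1 Q; have := divn_eq k Q.
    by rewrite modnS kQ divnS // kQ mulnDl; lia.
  by rewrite divff ?gt_eqF // mul0r (comb0 catX) (comb1 catX).
rewrite (comb_dist_param catX) ?frac01 //; last first.
  by rewrite divr_ge0 //= ler_pdivrMr // mul1r ler_nat ltn_pmod.
have -> : (k %% Q)%:R / Q%:R - (k %% Q).+1%:R / Q%:R = - Q%:R^-1 :> R.
  by rewrite -addn1 natrD; ring.
by rewrite normrN ger0_norm ?invr_ge0 // mulrC ler_pM2r ?invr_gt0.
Qed.

Lemma grid_path_near (p : nat -> X) (L : R) k l :
  (forall m, mdist (p m) (p m.+1) <= L) -> (k <= l.+1)%N -> (l <= k.+1)%N ->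
  mdist (grid_path p k) (grid_path p l) <= L / Q%:R.
Proof.
move=> pL kl lk; have L0 : 0 <= L by apply: le_trans (pL 0%N); exact: mdist_ge0.
have [->|[->|->]] : k = l \/ l = k.+1 \/ k = l.+1 by lia.
- by rewrite mdistxx divr_ge0.
- exact: grid_path_step.
- by rewrite metric_sym; exact: grid_path_step.
Qed.

Lemma grid_path_convex (p q : nat -> X) (B : R) k :
  (forall m, mdist (p m) (q m) <= B) ->
  mdist (grid_path p k) (grid_path q k) <= B.
Proof.
move=> pqB; apply: le_trans (comb_convex catX _ _ _ _ (frac01 k)) _.
have /andP[] := frac01 k; set t := _ / _ => t0 t1.
have := pqB (k %/ Q)%N; have := pqB (k %/ Q).+1; nra.
Qed.

Section Lipschitz.
Variables (phi : ('I_n -> nat) -> X) (L : R).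
Hypothesis phiL : forall z i m, mdist (phi (upd z i m)) (phi (upd z i m.+1)) <= L.

Lemma interp_upd s v z i m : i \notin s ->
  mdist (interp phi s v (upd z i m)) (interp phi s v (upd z i m.+1)) <= L.
Proof.
elim: s z => [|j s IH] z; first by move=> _; exact: phiL.
rewrite inE negb_or => /andP[ij is'] /=; apply: grid_path_convex => l.
by rewrite !(updC _ _ _ ij); exact: IH.
Qed.

Lemma interp_near s v w z : uniq s ->
  (forall j, v j <= (w j).+1)%N -> (forall j, w j <= (v j).+1)%N ->
  mdist (interp phi s v z) (interp phi s w z) <= (size s)%:R * (L / Q%:R).
Proof.
move=> us vw wv; elim: s us z => [|j s IH] /= us z; first by rewrite mdistxx mul0r.
case/andP: us => js us; rewrite mulrSr mulrDl mul1r addrC.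
apply: le_trans (metric_triangle _
  (grid_path (fun m => interp phi s v (upd z j m)) (w j)) _) _.
apply: lerD; first by apply: grid_path_near => // m; exact: interp_upd.
by apply: grid_path_convex => m; exact: IH.
Qed.

Lemma interp_corner s v z : uniq s ->
  mdist (interp phi s v z) (phi (fun i => if i \in s then (v i %/ Q)%N else z i))
    <= (size s)%:R * L.
Proof.
elim: s z => [|j s IH] z /= us; first by rewrite mdistxx mul0r.
case/andP: us => js us; rewrite mulrSr mulrDl mul1r addrC.
apply: le_trans (metric_triangle _ (interp phi s v (upd z j (v j %/ Q)%N)) _) _.
apply: lerD.
  rewrite metric_sym /grid_path.
  have [-> _] := comb_dist catX (interp phi s v (upd z j (v j %/ Q)))
    (interp phi s v (upd z j (v j %/ Q).+1)) (frac01 (v j)).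
  have /andP[_ t1] := frac01 (v j).
  by apply: le_trans (interp_upd v z (v j %/ Q)%N js); rewrite ler_piMl ?mdist_ge0.
have := IH (upd z j (v j %/ Q)%N) us; congr (_ <= _); congr (mdist _ (phi _)).
apply/funext => i; rewrite inE /upd; case: eqVneq => [->|] //=.
by rewrite (negbTE js).
Qed.

End Lipschitz.

Lemma interp_ind (D : X -> Prop) phi s v z : (forall z, D (phi z)) ->
  (forall x y t, 0 <= t <= 1 -> D x -> D y -> D (comb x y t)) ->
  D (interp phi s v z).
Proof.
move=> Dphi Dcomb; elim: s z => [|j s IH] z //=.
by apply: Dcomb; [exact: frac01 | exact: IH | exact: IH].
Qed.

End Interpolation.

Lemma exists_nat_div_lt (R : realType) (C lam : R) : 0 <= C -> 0 < lam ->
  exists Q : nat, (0 < Q)%N /\ C / Q%:R < lam.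
Proof.
move=> C0 lam0; exists (Num.bound (C / lam)).+1; split=> //.
rewrite ltr_pdivrMr ?ltr0n // mulrC -ltr_pdivrMr //.
by apply: lt_trans (archi_boundP _) _; rewrite ?divr_ge0 ?(ltW lam0) // ltr_nat.
Qed.

Section Flats.
Context {R : realType} {X : metricType R} {n : nat}.
Variable act : 'rV[int]_n -> X -> X.
Hypotheses (properX : proper_space X) (catX : CAT0 X).
Hypotheses (actP : isometric_action act) (act_proper : proper_action act).
Implicit Types (x y : X) (z v w : 'I_n -> nat).

Definition lattice_point z : 'rV[int]_n := \row_i (z i)%:Z.

Definition orbit_lip x : R := \sum_(i < n) mdist x (act (delta_mx 0 i) x).

Lemma orbit_lip_ge0 x : 0 <= orbit_lip x.
Proof. by apply: sumr_ge0 => i _; exact: mdist_ge0. Qed.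

Lemma orbit_lipP x z i m :
  mdist (act (lattice_point (upd z i m)) x)
        (act (lattice_point (upd z i m.+1)) x) <= orbit_lip x.
Proof.
have -> : lattice_point (upd z i m.+1) = lattice_point (upd z i m) + delta_mx 0 i.
  apply/rowP => j; rewrite !mxE /upd eqxx /=.
  case: eqVneq => _ /=; last by rewrite addr0.
  by rewrite -addn1 PoszD.
rewrite (actD actP) (act_dist actP) /orbit_lip (bigD1 i) //= lerDl.
by apply: sumr_ge0 => j _; exact: mdist_ge0.
Qed.

(** A coarse substitute for an equivariant map from [R^n] to [X]. *)
Definition flat (Q : nat) x v : X :=
  interp Q (fun z => act (lattice_point z) x) (enum 'I_n) v (fun=> 0%N).

Lemma flat_near Q x v w : (0 < Q)%N ->
  (forall j, v j <= (w j).+1)%N -> (forall j, w j <= (v j).+1)%N ->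
  mdist (flat Q x v) (flat Q x w) <= n%:R * orbit_lip x / Q%:R.
Proof.
move=> Q0 vw wv.
have := interp_near (phi := fun z => act (lattice_point z) x) catX Q0
  (orbit_lipP x) (fun=> 0%N) (enum_uniq 'I_n) vw wv.
by rewrite size_enum_ord mulrA.
Qed.

Lemma flat_corner Q x v : (0 < Q)%N ->
  mdist (flat Q x v) (act (lattice_point (fun i => v i %/ Q)%N) x)
    <= n%:R * orbit_lip x.
Proof.
move=> Q0.
have := interp_corner (phi := fun z => act (lattice_point z) x) catX Q0
  (orbit_lipP x) v (fun=> 0%N) (enum_uniq 'I_n).
rewrite size_enum_ord; congr (mdist _ (act (lattice_point _) _) <= _).
by apply/funext => i; rewrite mem_enum.
Qed.

(** By properness only finitely many group elements move [x] by at most [r]. *)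
Lemma orbit_coarse x (r : R) : exists D : nat, forall z w,
  mdist (act (lattice_point z) x) (act (lattice_point w) x) <= r ->
  forall i, (w i <= z i + D)%N.
Proof.
have /finite_seqP[s sE] := finite_orbit_ball properX actP act_proper x r.
exists (\sum_(g <- s) \sum_(i < n) absz (g ord0 i))%N => z w zw i.
have : [set` s] (lattice_point w - lattice_point z).
  by rewrite -sE /= -(act_dist actP (lattice_point z)) -(actD actP) addrC subrK.
move=> /= gs; rewrite (big_rem _ gs) /= (bigD1 i) //= !mxE.
set A := (\sum_(_ | _) _)%N; set B := (\sum_(_ <- _) _)%N; lia.
Qed.

Lemma orbit_bounded x (N : nat) : exists r : R, forall z, (forall i, z i <= N)%N ->
  mdist x (act (lattice_point z) x) <= r.
Proof.
exists (\sum_(u : {ffun 'I_n -> 'I_N.+1})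
  mdist x (act (lattice_point (fun i => u i)) x)) => z zN.
rewrite (bigD1 [ffun i => inord (z i)]) //=.
rewrite (_ : lattice_point _ = lattice_point z) ?lerDl; last first.
  by apply/rowP => i; rewrite !mxE ffunE inordK // ltnS.
by apply: sumr_ge0 => u _; exact: mdist_ge0.
Qed.

Lemma refinement_order_flat k x : has_refinements_of_order X k -> (n < k)%N.
Proof.
move=> refk; pose C := n%:R * orbit_lip x.
have C0 : 0 <= C by rewrite mulr_ge0 ?orbit_lip_ge0.
(* Corners of the box over points less than 1 apart are at most
   [1 + C *+ 2] apart. *)
have [D DP] := orbit_coarse x (1 + C *+ 2).
have [r rP] := orbit_bounded x D.+1.
apply: (refinement_order_gt (x := x) (r := r + C) (e := 1) properX _ refk)
  => // lam lam0.
have [Q [Q0 Qlam]] := exists_nat_div_lt C0 lam0.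
exists (D.+1 * Q)%N, (flat Q x).
have corner_le v : (forall j, v j <= D.+1 * Q)%N -> forall j, (v j %/ Q <= D.+1)%N.
  by move=> vM j; rewrite -(mulnK D.+1 Q0) leq_div2r.
split=> [v vM|v w _ _ vw wv|v w i vM wM vi wi].
- have := rP _ (corner_le _ vM); have := flat_corner x v Q0.
  have := metric_triangle x (act (lattice_point (fun i => v i %/ Q)%N) x) (flat Q x v).
  by rewrite (metric_sym (act _ x)) -/C; lra.
- by apply: le_lt_trans Qlam; exact: flat_near.
- rewrite leNgt; apply/negP => dvw.
  have cv := flat_corner x v Q0; have cw := flat_corner x w Q0.
  suff /DP/(_ i) : mdist (act (lattice_point (fun i => v i %/ Q)%N) x)
                         (act (lattice_point (fun i => w i %/ Q)%N) x) <= 1 + C *+ 2.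
    by rewrite vi wi div0n mulnK // add0n ltnn.
  apply: le_trans (metric_triangle _ (flat Q x v) _) _.
  rewrite metric_sym mulr2n addrCA lerD // addrC.
  apply: le_trans (metric_triangle _ (flat Q x w) _) _.
  by rewrite addrC lerD // ltW.
Qed.

End Flats.

(** * Displacement functions without a minimum *)

Section Parabolic.
Context {R : realType} {X : metricType R} {n : nat}.
Variable act : 'rV[int]_n -> X -> X.
Hypotheses (properX : proper_space X) (catX : CAT0 X).
Hypotheses (actP : isometric_action act) (act_proper : proper_action act).
Variable g : 'rV[int]_n.

Let disp (y : X) := mdist y (act g y).

Lemma disp_act h (y : X) : disp (act h y) = disp y.
Proof. by rewrite /disp -(actD actP) addrC (actD actP) (act_dist actP). Qed.

Lemma disp_lip y y' : disp y <= disp y' + mdist y y' *+ 2.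
Proof.
rewrite /disp; have := metric_triangle y y' (act g y).
have := metric_triangle y' (act g y') (act g y).
by rewrite (act_dist actP) (metric_sym y' y) mulr2n; lra.
Qed.

Lemma disp_convex (a : R) x y t : 0 <= t <= 1 -> disp x <= a -> disp y <= a ->
  disp (comb x y t) <= a.
Proof.
move=> t01 xa ya; rewrite /disp (comb_isometry catX _ _ (act_dist actP g) t01).
apply: le_trans (comb_convex catX _ _ _ _ t01) _.
by rewrite -/(disp x) -/(disp y); case/andP: t01; nra.
Qed.

Lemma flat_disp_le Q x v : (0 < Q)%N -> disp (flat act Q x v) <= disp x.
Proof.
move=> Q0; apply: (interp_ind Q0 (D := fun y => disp y <= disp x)).
  by move=> z; rewrite disp_act.
by move=> y y' t t01; exact: disp_convex.
Qed.

(** The grid has one more coordinate, the [time] along the geodesics from the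
    interpolated orbit of [x0] to that of [x1].  Opposite faces in the time
    direction differ in [disp] by at least [disp y0 - disp x1]; the other
    opposite faces are apart because the geodesics have bounded length. *)
Lemma refinement_order_no_min k (x0 : X) :
  (forall x, exists y, disp y < disp x) ->
  has_refinements_of_order X k -> (n.+1 < k)%N.
Proof.
move=> nomin refk.
pose C0 := n%:R * orbit_lip act x0.
have C0_ge0 : 0 <= C0 by rewrite mulr_ge0 ?orbit_lip_ge0.
(* Translating a point of the interpolated orbit of [x0] by the inverse of a
   nearby group element brings it into the ball of radius [C0] about [x0]
   without changing [disp]. *)
have [y0 y0min] := min_displacement_ball properX x0 C0_ge0 (act_dist actP g).
have [x1 x1y0] := nomin y0.
have flat0_disp Q v : (0 < Q)%N -> disp y0 <= disp (flat act Q x0 v).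
  move=> Q0; pose c := lattice_point (fun i => v i %/ Q)%N.
  rewrite -[leRHS](disp_act (- c)); apply: y0min.
  rewrite -(act_dist actP c) -(actD actP) subrr (act0 actP) metric_sym.
  exact: flat_corner.
pose C1 := n%:R * orbit_lip act x1.
have C1_ge0 : 0 <= C1 by rewrite mulr_ge0 ?orbit_lip_ge0.
pose C := C0 + mdist x0 x1 + C1.
have C_ge0 : 0 <= C by rewrite !addr_ge0 ?mdist_ge0.
have flat01 Q v : (0 < Q)%N -> mdist (flat act Q x0 v) (flat act Q x1 v) <= C.
  move=> Q0; have h0 := flat_corner catX actP x0 v Q0.
  have h1 := flat_corner catX actP x1 v Q0.
  move: h0 h1; rewrite -/C0 -/C1; set p := lattice_point _ => h0 h1.
  have := metric_triangle (flat act Q x0 v) (act p x0) (flat act Q x1 v).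
  have := metric_triangle (act p x0) (act p x1) (flat act Q x1 v).
  by rewrite (act_dist actP) (metric_sym (act p x1)) /C; lra.
(* The division by 2 comes from [disp_lip]: [disp] is 2-Lipschitz. *)
pose e := Num.min 1 ((disp y0 - disp x1) / 2).
have e_gt0 : 0 < e by rewrite lt_min ltr01 divr_gt0 // subr_gt0.
(* Points of the grid less than 1 apart start from points of the interpolated
   orbit of [x0] less than [1 + C *+ 2] apart, and the nearby orbit points are
   [C0] away from these. *)
have [D DP] :=
  orbit_coarse properX actP act_proper x0 (1 + C *+ 2 + C0 *+ 2).
have [r rP] := orbit_bounded act x0 D.+1.
apply: (refinement_order_gt (x := x0) (r := r + C0 + C) properX e_gt0 refk)
  => lam lam0.
have [Q [Q0 Qlam]] := exists_nat_div_lt (addr_ge0 (addr_ge0 C0_ge0 C1_ge0) C_ge0) lam0.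
pose M := (D.+1 * Q)%N; have M0 : (0 < M)%N by rewrite muln_gt0.
pose tail (v : 'I_n.+1 -> nat) (i : 'I_n) := v (lift ord0 i).
pose time (v : 'I_n.+1 -> nat) : R := (v ord0)%:R / M%:R.
pose F v := comb (flat act Q x0 (tail v)) (flat act Q x1 (tail v)) (time v).
have time01 v : (forall j, v j <= M)%N -> 0 <= time v <= 1.
  move=> vM; rewrite divr_ge0 //= ler_pdivrMr ?ltr0n // mul1r ler_nat.
  exact: vM.
have corner_le v : (forall j, v j <= M)%N -> forall j, (tail v j %/ Q <= D.+1)%N.
  by move=> vM j; rewrite -(mulnK D.+1 Q0) leq_div2r //; exact: vM.
have flat0F v : (forall j, v j <= M)%N -> mdist (flat act Q x0 (tail v)) (F v) <= C.
  move=> vM; have [-> _] := comb_dist catX (flat act Q x0 (tail v))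
    (flat act Q x1 (tail v)) (time01 _ vM).
  apply: le_trans (flat01 Q (tail v) Q0); rewrite ler_piMl ?mdist_ge0 //.
  by have /andP[] := time01 _ vM.
exists M, F; split=> [v vM|v w vM wM vw wv|v w i vM wM].
- have := rP _ (corner_le _ vM); have := flat_corner catX actP x0 (tail v) Q0.
  have := flat0F _ vM; rewrite -/C0.
  set p := act _ x0; set q := flat act Q x0 _.
  have := metric_triangle x0 q (F v); have := metric_triangle x0 p q.
  by rewrite (metric_sym p q); lra.
- apply: le_lt_trans Qlam; rewrite (mulrDl (C0 + C1)) (mulrDl C0).
  apply: le_trans (metric_triangle _ (comb (flat act Q x0 (tail w))
    (flat act Q x1 (tail w)) (time v)) _) _.
  apply: lerD.
    apply: le_trans (comb_convex catX _ _ _ _ (time01 _ vM)) _.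
    have h0 : mdist (flat act Q x0 (tail v)) (flat act Q x0 (tail w)) <= C0 / Q%:R.
      by apply: flat_near => // j; [exact: vw | exact: wv].
    have h1 : mdist (flat act Q x1 (tail v)) (flat act Q x1 (tail w)) <= C1 / Q%:R.
      by apply: flat_near => // j; [exact: vw | exact: wv].
    have /andP[t0 t1] := time01 _ vM.
    by apply: lerD; [apply: le_trans h0 | apply: le_trans h1];
       rewrite ler_piMl ?mdist_ge0 // gerBl.
  rewrite (comb_dist_param catX) ?time01 //.
  rewrite mulrC ler_pM ?mdist_ge0 ?flat01 //.
  rewrite /time -mulrBl normrM normfV normr_nat.
  have h : `|(v ord0)%:R - (w ord0)%:R : R| <= 1.
    have := vw ord0; have := wv ord0; rewrite -!(ler_nat R) -!natr1 => *.
    by rewrite ler_norml; lra.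
  apply: le_trans (ler_wpM2r _ h) _; first by rewrite invr_ge0.
  by rewrite mul1r lef_pV2 ?posrE ?ltr0n // ler_nat leq_pmull.
- case: (unliftP ord0 i) => [j ->|->] vi wi; last first.
    have -> : F v = flat act Q x0 (tail v) by rewrite /F /time vi mul0r (comb0 catX).
    have -> : F w = flat act Q x1 (tail w).
      by rewrite /F /time wi divff ?(comb1 catX) // pnatr_eq0 -lt0n.
    rewrite ge_min; apply/orP; right; rewrite ler_pdivrMr // mulr_natr.
    have := disp_lip (flat act Q x0 (tail v)) (flat act Q x1 (tail w)).
    by have := flat0_disp Q (tail v) Q0; have := flat_disp_le x1 (tail w) Q0; lra.
  rewrite ge_min leNgt; apply/orP; left; apply/negP => dvw.
  have cv := flat_corner catX actP x0 (tail v) Q0.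
  have cw := flat_corner catX actP x0 (tail w) Q0.
  suff /DP/(_ j) : mdist (act (lattice_point (fun i => tail v i %/ Q)%N) x0)
      (act (lattice_point (fun i => tail w i %/ Q)%N) x0) <= 1 + C *+ 2 + C0 *+ 2.
    by rewrite /tail vi wi div0n mulnK // add0n ltnn.
  have := flat0F _ vM; have := flat0F _ wM; rewrite -/C0 in cv cw; move: cv cw dvw.
  set p := act _ x0; set p' := act _ x0.
  set q := flat _ _ _ _; set q' := flat _ _ _ _.
  have := metric_triangle p q p'; have := metric_triangle q q' p'.
  have := metric_triangle q (F v) q'; have := metric_triangle (F v) (F w) q'.
  by rewrite (metric_sym p q) (metric_sym (F w) q') !mulr2n; lra.
Qed.

End Parabolic.

Theorem proposition5p1 (R : realType) (X : metricType R) (n : nat)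
    (act : 'rV[int]_n -> X -> X) :
  [set: X] !=set0 -> proper_space X -> CAT0 X ->
  isometric_action act -> proper_action act ->
  (n%:R%:E <= covering_dim X)%E /\
  (covering_dim X = n%:R%:E -> semi_simple_action act).
Proof.
move=> [x0 _] properX catX actP act_proper.
have dim_ge (m : nat) : (forall k, has_refinements_of_order X k -> (m < k)%N) ->
    (m%:R%:E <= covering_dim X)%E.
  move=> h; apply: le_ereal_inf_tmp => _ [k /h mk <-].
  by rewrite lee_fin lerBrDr natr1 ler_nat.
split.
  apply: dim_ge => k.
  exact: (refinement_order_flat properX catX actP act_proper x0).
move=> dimX g.
have [[x minx]|nomin] :=
  pselect (exists x, forall y, mdist x (act g x) <= mdist y (act g y)).
  exact: (min_displacement_semi_simple catX actP minx).
suff : (n.+1%:R%:E <= covering_dim X)%E by rewrite dimX lee_fin ler_nat ltnn.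
apply: dim_ge => k.
apply: (refinement_order_no_min properX catX actP act_proper (g := g) x0) => x.
apply: contrapT => nex; apply: nomin; exists x => y.
rewrite leNgt; apply/negP => yx.
by apply: nex; exists y.
Qed.
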